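(* Let $\|\cdot\|:\mathbb{R}^m\to\mathbb{R}$ be a convex functional. Let $L$ and $\tilde L$ be linear operators on $\mathbb{R}^m$ such that $$\|e^{\tau L}u\|\le\|u\| \quad\text{and}\quad \|e^{-\tau\tilde L}u\|\le\|u\|\qquad\text{for all } \tau\ge 0 \text{ and all } u\in\mathbb{R}^m .$$ Let $N:\mathbb{R}^m\to\mathbb{R}^m$ be a (possibly nonlinear) operator such that, for some $\Delta t_{\mathrm{FE}}>0$, $$\|u+\Delta t\,N(u)\|\le\|u\|\qquad\text{for all } u\in\mathbb{R}^m \text{ and all } 0\le\Delta t\le\Delta t_{\mathrm{FE}} .$$ Let $\alpha_{i,j},\beta_{i,j}$ ($0\le j<i\le s$) be the coefficients, and $c_0,\dots,c_s$ the abscissas, of an explicit $s$-stage Runge--Kutta method in the form described in the context. Given $u^n\in\mathbb{R}^m$ and $\Delta t\geq 0$, let $u^{n+1}$ be obtained from the integrating factor Runge--Kutta method $$u^{(0)}=u^n,$$ $$u^{(i)}=\sum_{j=0}^{i-1}e^{L^*_{ij}(c_i-c_j)\Delta t}\left(\alpha_{i,j}u^{(j)}+\Delta t\,\beta_{i,j}N(u^{(j)})\right),\qquad i=1,\dots,s,$$ $$u^{n+1}=u^{(s)},$$ where $L^*_{ij}=L$ when $c_i\ge c_j$ and $L^*_{ij}=\tilde L$ when $c_i<c_j$. Then $$\|u^{n+1}\|\le\|u^n\|\qquad\text{for all } 0\le\Delta t\le\mathcal{C}\,\Delta t_{\mathrm{FE}},\qquad\text{where}\quad \mathcal{C}=\min_{i,j}\frac{\alpha_{i,j}}{\beta_{i,j}}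 .$$
   Context: The setting is an ODE system $u_t=Lu+N(u)$ on $\mathbb{R}^m$ (a semi-discretized PDE) with $L$ a constant coefficient linear operator; $\tilde L$ is a second (''downwinded'') linear operator. $e^{A}$ denotes the matrix exponential. An explicit $s$-stage Runge--Kutta method for $u_t=F(u)$ is written as $u^{(0)}=u^n$, $u^{(i)}=\sum_{j=0}^{i-1}\left(\alpha_{i,j}u^{(j)}+\Delta t\,\beta_{i,j}F(u^{(j)})\right)$ for $i=1,\dots,s$, $u^{n+1}=u^{(s)}$, where the coefficients satisfy: $\alpha_{i,j}\ge0$ and $\beta_{i,j}\ge 0$; $\sum_{j=0}^{i-1}\alpha_{i,j}=1$ for each $i=1,\dots,s$ (consistency); and $\alpha_{i,j}=0$ only if $\beta_{i,j}=0$. The abscissa $c_i$ is the number such that stage $u^{(i)}$ approximates the solution at time $t^n+c_i\Delta t$; that is, $c_0=0$ and $c_i=\sum_{j=0}^{i-1}(\alpha_{i,j}c_j+\beta_{i,j})$. The abscissas are not assumed to be non-decreasing. In the definition of $\mathcal{C}$, the minimum is over $0\le j<i\le s$, and the ratio $\alpha_{i,j}/\beta_{i,j}$ is considered infinite whenever $\beta_{i,j}=0$. *)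

(* Defs.v *)
From HB Require Import structures.
From mathcomp Require Import all_boot all_order all_algebra.
From mathcomp Require Import all_classical all_reals all_analysis.

Set Implicit Arguments.
Unset Strict Implicit.
Unset Printing Implicit Defensive.

Import Order.TTheory GRing.Theory Num.Theory.
Import numFieldNormedType.Exports.

Local Open Scope classical_set_scope.
Local Open Scope ring_scope.

(* The limit is taken in the (entrywise) topology of 'M[R]_m, in which the
   exponential series converges for every A. *)
Definition expmx (R : realType) (m : nat) (A : 'M[R]_m) : 'M[R]_m :=
  limn (series (fun k : nat => k`!%:R^-1 *: A ^+ k)).

(* Coefficient arrays are total functions of two naturals; only the entries
   with j < i <= s are constrained, and only those are ever used. *)
Record explicit_rk (R : realType) (s : nat) (alpha beta : nat -> nat -> R) :
    Prop := ExplicitRK {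
  rk_alpha_ge0 : forall i j : nat, (j < i <= s)%N -> 0 <= alpha i j;
  rk_beta_ge0 : forall i j : nat, (j < i <= s)%N -> 0 <= beta i j;
  rk_consistent : forall i : nat, (1 <= i <= s)%N ->
    \sum_(j < i) alpha i j = 1;
  rk_alpha_eq0 : forall i j : nat, (j < i <= s)%N ->
    alpha i j = 0 -> beta i j = 0
}.

(* The recursion determines c uniquely on 0, ..., s. *)
Definition rk_abscissas (R : realType) (s : nat) (alpha beta : nat -> nat -> R)
    (c : nat -> R) : Prop :=
  c 0%N = 0 /\
  forall i : nat, (1 <= i <= s)%N ->
    c i = \sum_(j < i) (alpha i j * c j + beta i j).

Definition rk_ratio (R : realType) (a b : R) : \bar R :=
  if b == 0 then +oo%E else (a / b)%:E.

(* Extended-real valued: it is +oo when every beta i j vanishes. *)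
Definition rk_ssp_coef (R : realType) (s : nat)
    (alpha beta : nat -> nat -> R) : \bar R :=
  \big[mine/+oo%E]_(1 <= i < s.+1) \big[mine/+oo%E]_(0 <= j < i)
    rk_ratio (alpha i j) (beta i j).

Definition if_operator (R : realType) (m : nat) (L Lt : 'M[R]_m)
    (c : nat -> R) (i j : nat) : 'M[R]_m :=
  if c j <= c i then L else Lt.

(* v is the result of one step of size dt from un; u lists the stages. *)
Definition ifrk_step (R : realType) (m s : nat) (L Lt : 'M[R]_m)
    (N : 'cV[R]_m -> 'cV[R]_m) (alpha beta : nat -> nat -> R) (c : nat -> R)
    (dt : R) (un v : 'cV[R]_m) : Prop :=
  exists u : nat -> 'cV[R]_m,
    [/\ u 0%N = un,
        forall i : nat, (1 <= i <= s)%N ->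
          u i = \sum_(j < i)
                  expmx (((c i - c j) * dt) *: if_operator L Lt c i j) *m
                  (alpha i j *: u j + (dt * beta i j) *: N (u j))
      & v = u s].

(* Main.v *)
Require Import Defs.
From HB Require Import structures.
From mathcomp Require Import all_boot all_order all_algebra.
From mathcomp Require Import all_classical all_reals all_analysis.

Set Implicit Arguments.
Unset Strict Implicit.
Unset Printing Implicit Defensive.

Import Order.TTheory GRing.Theory Num.Theory.
Import numFieldNormedType.Exports.

Local Open Scope classical_set_scope.
Local Open Scope ring_scope.

(** The set of vectors on which [nrm] is at most [nrm un] contains every stage,
    by strong induction on the stage index.  When [alpha i j] is positive, the
    [j]-th term of stage [i] is [alpha i j] times
      [expmx ((c i - c j) * dt *: _) *m (u j + tau *: N (u j))],
    with [tau = dt * (beta i j / alpha i j)].  The bound on [dt] is precisely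
    what makes every [tau] at most [dtFE], so the bracket is an admissible
    forward Euler step and does not increase [nrm].  Neither does the
    exponential: choosing [L] or [Lt] by the sign of [c i - c j] guarantees that
    [L] only runs forward and [Lt] only backward.  The stage is therefore a
    convex combination of vectors of the sublevel set, and Jensen's inequality
    concludes.  The three ingredients are [rk_euler_step_le],
    [expmx_if_operator_le] and [convex_function_sum_le]. *)

(** The statement is in a form that survives vanishing total weight, which
    happens on partial sums even when the full sum of weights is 1: the sum of
    vectors is written as its total weight times some [z], and the convexity
    bound is multiplied through by that weight. *)
Lemma convex_function_cone (R : realFieldType) (E : lmodType R) (f : E -> R)
    (I : Type) (r : seq I) (P : pred I) (a : I -> R) (y : I -> E) :
    convex_function [set: convex_lmodType E] f ->
    (forall i, P i -> 0 <= a i) ->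
  exists2 z : E,
    \sum_(i <- r | P i) a i *: y i = (\sum_(i <- r | P i) a i) *: z
    & (\sum_(i <- r | P i) a i) * f z <= \sum_(i <- r | P i) a i * f (y i).
Proof.
move=> cf a_ge0.
(* The induction also needs the partial weights to be nonnegative. *)
suff [] : 0 <= \sum_(i <- r | P i) a i /\ exists2 z : E,
    \sum_(i <- r | P i) a i *: y i = (\sum_(i <- r | P i) a i) *: z
    & (\sum_(i <- r | P i) a i) * f z <= \sum_(i <- r | P i) a i * f (y i).
  by [].
elim/big_rec3: _ => [|i b v w Pi [w_ge0 [z -> fz]]].
  by split=> //; exists 0; rewrite ?scaler0 ?mul0r.
have ai_ge0 := a_ge0 i Pi.
split; first exact: addr_ge0.
(* A new vector joins [z] in the proportion a i : w, unless both weights are 0,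
   in which case any [z] will do. *)
have [aw0|aw_neq0] := eqVneq (a i + w) 0.
  have /andP[/eqP ai0 /eqP w0] : (a i == 0) && (w == 0).
    by rewrite -paddr_eq0 // aw0.
  rewrite w0 mul0r in fz.
  by exists 0; rewrite aw0 ai0 ?w0 ?scale0r ?addr0 ?mul0r ?add0r.
have aw_gt0 : 0 < a i + w by rewrite lt_def aw_neq0 addr_ge0.
have [p [p_ge0 p_le1 ap]] : exists p : R,
    [/\ 0 <= p, p <= 1 & (a i + w) * p = a i].
  exists (a i / (a i + w)); split; first by rewrite divr_ge0 // ltW.
    by rewrite ler_pdivrMr // mul1r lerDl.
  by rewrite mulrC divfK.
have wp : (a i + w) * unstable.onem p = w.
  by rewrite /unstable.onem mulrBr mulr1 ap addrC addKr.
have := cf (Itv01 p_ge0 p_le1) (y i) z (in_setT _) (in_setT _).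
set x := conv _ _ _ => fx.
exists x.
  by rewrite [x]/(p *: y i + unstable.onem p *: z) scalerDr !scalerA ap wp.
apply: le_trans (_ : a i * f (y i) + w * f z <= _); last by rewrite lerD2l.
apply: le_trans (ler_wpM2l (ltW aw_gt0) fx) _.
by rewrite convRE /= mulrDr !mulrA ap wp.
Qed.

Lemma convex_function_sum_le (R : realFieldType) (E : lmodType R) (f : E -> R)
    (I : Type) (r : seq I) (P : pred I) (a : I -> R) (y : I -> E) (M : R) :
    convex_function [set: convex_lmodType E] f ->
    (forall i, P i -> 0 <= a i) -> \sum_(i <- r | P i) a i = 1 ->
    (forall i, P i -> f (y i) <= M) ->
  f (\sum_(i <- r | P i) a i *: y i) <= M.
Proof.
move=> cf a_ge0 a_sum1 fy_le.
have [z -> ] := convex_function_cone r y cf a_ge0.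
rewrite a_sum1 scale1r mul1r => /le_trans; apply.
rewrite -[M]mul1r -a_sum1 mulr_suml; apply: ler_sum => i Pi.
by rewrite ler_wpM2l ?a_ge0 ?fy_le.
Qed.

Lemma rk_ssp_coef_le_ratio (R : realType) (s : nat)
    (alpha beta : nat -> nat -> R) (i j : nat) : (j < i <= s)%N ->
  (rk_ssp_coef s alpha beta <= rk_ratio (alpha i j) (beta i j))%E.
Proof.
case/andP=> j_lt_i i_le_s; rewrite /rk_ssp_coef.
apply: (bigmin_inf_seq _ i) => //.
  by rewrite mem_index_iota ltnS i_le_s (leq_ltn_trans _ j_lt_i).
by apply: (bigmin_inf_seq _ j) => //; rewrite mem_index_iota.
Qed.

(** The forward Euler step hidden in the pair [(i, j)] is admissible.  If
    [alpha i j = 0] then [beta i j = 0] as well and the quotient is 0, so such a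
    pair contributes a step of length 0 with weight 0 and fits in the same convex
    combination as the others. *)
Lemma rk_euler_step_le (R : realType) (s : nat) (alpha beta : nat -> nat -> R)
    (h dt : R) (i j : nat) :
    explicit_rk s alpha beta -> 0 <= h -> 0 <= dt ->
    (dt%:E <= rk_ssp_coef s alpha beta * h%:E)%E -> (j < i <= s)%N ->
  0 <= dt * (beta i j / alpha i j) <= h.
Proof.
move=> rk h_ge0 dt_ge0 dt_le ij.
have a_ge0 := rk_alpha_ge0 rk ij; have b_ge0 := rk_beta_ge0 rk ij.
rewrite mulr_ge0 ?divr_ge0 //=.
have [b0|b_neq0] := eqVneq (beta i j) 0; first by rewrite b0 mul0r mulr0.
have a_neq0 : alpha i j != 0.
  by apply: contra_neq b_neq0; apply: rk_alpha_eq0 rk _ _ ij.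
have h_ge0E : (0 <= h%:E)%E by rewrite lee_fin.
have := le_trans dt_le (lee_wpmul2r h_ge0E (rk_ssp_coef_le_ratio alpha beta ij)).
rewrite /rk_ratio (negbTE b_neq0) -EFinM lee_fin => dt_le'.
have ba_ge0 : 0 <= beta i j / alpha i j by rewrite divr_ge0.
apply: le_trans (ler_wpM2r ba_ge0 dt_le') _.
by rewrite mulrAC mulrA divfK // divff // mul1r.
Qed.

(** The sign of [c i - c j] decides both the operator and the direction in
    which it runs; both cases are contractive by hypothesis. *)
Lemma expmx_if_operator_le (R : realType) (m : nat) (nrm : 'cV[R]_m -> R)
    (L Lt : 'M[R]_m) (c : nat -> R) (i j : nat) (dt : R) (u : 'cV[R]_m) :
    (forall (tau : R) (u : 'cV[R]_m), 0 <= tau ->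
      nrm (expmx (tau *: L) *m u) <= nrm u) ->
    (forall (tau : R) (u : 'cV[R]_m), 0 <= tau ->
      nrm (expmx ((- tau) *: Lt) *m u) <= nrm u) ->
    0 <= dt ->
  nrm (expmx (((c i - c j) * dt) *: if_operator L Lt c i j) *m u) <= nrm u.
Proof.
move=> expL expLt dt_ge0; rewrite /if_operator.
case: (leP (c j) (c i)) => [cji|/ltW cij].
  by apply: expL; rewrite mulr_ge0 // subr_ge0.
have -> : (c i - c j) * dt = - ((c j - c i) * dt) by rewrite -mulNr opprB.
by apply: expLt; rewrite mulr_ge0 // subr_ge0.
Qed.

Theorem theorem2 (R : realType) (m : nat)
  (nrm : 'cV[R]_m -> R)
  (nrm_convex : convex_function [set: convex_lmodType 'cV[R]_m] nrm)
  (L Lt : 'M[R]_m)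
  (expL : forall (tau : R) (u : 'cV[R]_m), 0 <= tau ->
    nrm (expmx (tau *: L) *m u) <= nrm u)
  (expLt : forall (tau : R) (u : 'cV[R]_m), 0 <= tau ->
    nrm (expmx ((- tau) *: Lt) *m u) <= nrm u)
  (N : 'cV[R]_m -> 'cV[R]_m)
  (dtFE : R) (dtFE_gt0 : 0 < dtFE)
  (forward_euler : forall (u : 'cV[R]_m) (dt : R), 0 <= dt <= dtFE ->
    nrm (u + dt *: N u) <= nrm u)
  (s : nat) (alpha beta : nat -> nat -> R)
  (rk : explicit_rk s alpha beta)
  (c : nat -> R) (c_abscissas : rk_abscissas s alpha beta c)
  (un un1 : 'cV[R]_m) (dt : R) (dt_ge0 : 0 <= dt)
  (step : ifrk_step s L Lt N alpha beta c dt un un1)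
  (dt_le : (dt%:E <= rk_ssp_coef s alpha beta * dtFE%:E)%E) :
  nrm un1 <= nrm un.
Proof.
case: step => u [u0 u_stage ->].
suff stage_le i : (i <= s)%N -> nrm (u i) <= nrm un by exact: stage_le.
elim/ltn_ind: i => -[|i] IH i_le_s; first by rewrite u0.
set tau := fun j : nat => dt * (beta i.+1 j / alpha i.+1 j).
have ji (j : 'I_i.+1) : (j < i.+1 <= s)%N by rewrite ltn_ord i_le_s.
have stage_term (j : 'I_i.+1) :
    alpha i.+1 j *: u j + (dt * beta i.+1 j) *: N (u j) =
    alpha i.+1 j *: (u j + tau j *: N (u j)).
  rewrite scalerDr scalerA /tau; congr (_ + _ *: _).
  have [a0|a_neq0] := eqVneq (alpha i.+1 j) 0.
    by rewrite a0 mul0r (rk_alpha_eq0 rk (ji j) a0) mulr0.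
  by rewrite mulrCA [_ / _]mulrC mulVKf.
rewrite u_stage //.
under eq_bigr => j _ do rewrite stage_term -scalemxAr.
apply: (convex_function_sum_le nrm_convex) => [j _||j _].
- exact: (rk_alpha_ge0 rk (ji j)).
- by apply: (rk_consistent rk).
apply: le_trans (expmx_if_operator_le _ _ _ _ expL expLt dt_ge0) _.
have tau_le : 0 <= tau j <= dtFE.
  exact: rk_euler_step_le rk (ltW dtFE_gt0) dt_ge0 dt_le (ji j).
apply: le_trans (forward_euler _ _ tau_le) _.
by apply: IH => //; apply: leq_trans (ltnW (ltn_ord j)) _.
Qed.
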